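(* Let $v_0\in\mathbb R^2$, $v_0\ne 0$, and let $t_f$ be the optimal time of the time-optimal return problem with initial velocity $v_0$: $\dot x=v$, $\dot v=u$, $|u|\le 1$, $x(0)=x(t_f)=0$, $v(0)=v_0$, $v(t_f)=(-1,0)$, $t_f\to\min$. Let $t_f'$ be the optimal time of the same problem with initial velocity $v_0'=v_0|v_0|^{-2}$ in place of $v_0$ (and the same terminal velocity $(-1,0)$). Then $t_f'=t_f\,|v_0|^{-1}$.
   Context: Time-optimal return problem: for a given initial velocity $v_0\in\mathbb R^2$, consider the controlled system $\dot x=v$, $\dot v=u$ with $x,v,u\in\mathbb R^2$ and Euclidean constraint $|u(t)|\le 1$, where admissible controls $u$ are piecewise continuous functions of time. The boundary conditions are $x(0)=0$, $v(0)=v_0$, $x(t_f)=0$, $v(t_f)=v_f=(-1,0)$. The terminal time $t_f\ge 0$ is to be minimized over admissible controls; its minimum value is called the optimal time. *)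

(* Defs.v *)
From Stdlib Require Import Reals List.
From Coquelicot Require Import Coquelicot.

Open Scope R_scope.

(** Only the values on [[0, T]] matter, here and in the definitions below: the
    functions are total, but limits and derivatives are one-sided or taken at
    interior points.  Discontinuities are of the first kind, and the values at
    the discontinuities are free. *)
Definition piecewise_continuous (T : R) (u : R -> R * R) : Prop :=
  (forall t : R, 0 < t <= T ->
     exists a : R * R, filterlim u (at_left t) (locally a)) /\
  (forall t : R, 0 <= t < T ->
     exists a : R * R, filterlim u (at_right t) (locally a)) /\
  exists l : list R, forall t : R, 0 < t < T -> ~ In t l ->
     continuous u t.

(** On [R * R], Coquelicot's [norm] is the Euclidean one:
    [norm (a, b) = sqrt (norm a ^ 2 + norm b ^ 2)]. *)
Definition admissible_control (T : R) (u : R -> R * R) : Prop :=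
  piecewise_continuous T u /\
  forall t : R, 0 <= t <= T -> norm (u t) <= 1.

Definition continuous_on_segment (T : R) (f : R -> R * R) : Prop :=
  forall t : R, 0 <= t <= T ->
    filterlim f
      (within (fun s : R => 0 <= s <= T) (locally t)) (locally (f t)).

(** The velocity has corners at the jumps of the control, so [v' = u] is
    required at the points of continuity of [u] only. *)
Definition trajectory (T : R) (x v u : R -> R * R) : Prop :=
  continuous_on_segment T x /\ continuous_on_segment T v /\
  (forall t : R, 0 < t < T -> is_derive x t (v t)) /\
  (forall t : R, 0 < t < T -> continuous u t ->
     is_derive v t (u t)).

Definition return_time (v0 : R * R) (T : R) : Prop :=
  0 <= T /\
  exists x v u : R -> R * R,
    admissible_control T u /\ trajectory T x v u /\
    x 0 = (0, 0) /\ v 0 = v0 /\ x T = (0, 0) /\ v T = (-1, 0).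

Definition optimal_time (v0 : R * R) (T : R) : Prop :=
  return_time v0 T /\ forall T' : R, return_time v0 T' -> T <= T'.

(* Main.v *)
Require Import Defs.
From Stdlib Require Import Reals List Lra.
From Coquelicot Require Import Coquelicot.

Open Scope R_scope.

(** Time reversal, the dilation [(t, x, v) -> (l t, l^2 x, l v)] with
    [l = 1 / |v0|], and the reflection exchanging [v0 / |v0|] with [(1, 0)]
    together turn a return trajectory from [v0] in time [T] into one from
    [v0 / |v0|^2] in time [T / |v0|].  As the inversion [v0 -> v0 / |v0|^2] is
    an involution, the two sets of return times are proportional, and so are
    their minima. *)

(** * Euclidean norm and reflections of the plane *)

Lemma norm_pair (a b : R) : norm (a, b) = sqrt (a ^ 2 + b ^ 2).
Proof.
  change (sqrt (Rabs a ^ 2 + Rabs b ^ 2) = sqrt (a ^ 2 + b ^ 2)).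
  now rewrite !pow2_abs.
Qed.

Lemma norm_scal_nonneg (c : R) (z : R * R) :
  0 <= c -> norm (scal c z) = c * norm z.
Proof.
  intros Hc; destruct z as [a b].
  change (scal c (a, b)) with (c * a, c * b).
  rewrite !norm_pair.
  transitivity (sqrt (c ^ 2) * sqrt (a ^ 2 + b ^ 2)).
  2: now rewrite sqrt_pow2.
  rewrite <- sqrt_mult_alt by nra; f_equal; ring.
Qed.

(** For [p^2 + q^2 = 1], the reflection exchanging [(1, 0)] and [(p, q)]. *)
Definition reflect (p q : R) (z : R * R) : R * R :=
  (p * fst z + q * snd z, q * fst z - p * snd z).

(** The matrix with rows [(p, q)] and [(q, -p)] squares to [p^2 + q^2] times the identity. This is
    what lets a reversed control be turned back into the original one. *)
Lemma reflectK (p q : R) (z : R * R) :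
  p ^ 2 + q ^ 2 = 1 -> reflect p q (reflect p q z) = z.
Proof.
  intros H; destruct z as [a b]; unfold reflect; simpl; f_equal.
  - replace a with ((p ^ 2 + q ^ 2) * a) at 3 by (rewrite H; ring); ring.
  - replace b with ((p ^ 2 + q ^ 2) * b) at 3 by (rewrite H; ring); ring.
Qed.

Lemma norm_reflect (p q : R) (z : R * R) :
  p ^ 2 + q ^ 2 = 1 -> norm (reflect p q z) = norm z.
Proof.
  intros H; destruct z as [a b]; unfold reflect; rewrite !norm_pair; simpl fst; simpl snd.
  f_equal.
  replace (a ^ 2 + b ^ 2) with ((p ^ 2 + q ^ 2) * (a ^ 2 + b ^ 2))
    by (rewrite H; ring).
  ring.
Qed.

Lemma is_linear_reflect (p q : R) : p ^ 2 + q ^ 2 = 1 ->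
  is_linear (reflect p q).
Proof.
  intros H; split.
  - intros [a b] [c d]; unfold reflect; simpl.
    apply injective_projections; simpl; unfold plus; simpl; ring.
  - intros k [a b]; unfold reflect; simpl.
    apply injective_projections; simpl; unfold scal; simpl; unfold mult; simpl; ring.
  (* The map is an isometry, hence bounded with constant 1. *)
  - exists 1; split; [lra|]; intros z.
    rewrite norm_reflect by exact H; lra.
Qed.

Lemma is_linear_scal_reflect (c p q : R) : p ^ 2 + q ^ 2 = 1 ->
  is_linear (fun z => scal c (reflect p q z)).
Proof.
  intros H.
  apply (is_linear_comp (reflect p q) (fun z : R * R => scal c z)).
  - now apply is_linear_reflect.
  - apply @is_linear_scal_r; intros; apply Rmult_comm.
Qed.

(** * Affine time reversal [s -> T - n * s] *)

(** Chain rule: the time change contributes the factor [- n], and [L] is its own differential. It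
    serves for positions and velocities alike, with different [L]. *)
Lemma is_derive_linear_reversal (L : R * R -> R * R) (f : R -> R * R)
  (T n s : R) (l : R * R) : is_linear L ->
  is_derive f (T - n * s) l ->
  is_derive (fun s => L (f (T - n * s))) s (scal (- n) (L l)).
Proof.
  intros HL Hf.
  assert (Hr : is_derive (fun s : R => T - n * s) s (- n)).
  { auto_derive; [easy | ring]. }
  assert (Hc := is_derive_comp f (fun s : R => T - n * s) s l (- n) Hf Hr).
  rewrite <- (linear_scal L HL).
  unfold is_derive in *.
  (* Composition yields the differential [y -> L (y * l')], while [is_derive] asks for
     [y -> y * L l'], where [l'] is [- n] times [l]; linearity identifies them. *)
  eapply filterdiff_ext_lin.
  - apply (filterdiff_comp' (fun s => f (T - n * s)) L).
    + exact Hc.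
    + apply filterdiff_linear; exact HL.
  - intros y; simpl. now rewrite (linear_scal L HL).
Qed.

Lemma continuous_reversal (T n s : R) :
  continuous (fun s : R => T - n * s) s.
Proof. apply @ex_derive_continuous; auto_derive; easy. Qed.

(** For positive [n] the time change is decreasing, so it exchanges the two sides of a point: left
    limits of a reversed control come from right limits of the original one. *)
Lemma reversal_at_left (T n s : R) : 0 < n ->
  filterlim (fun s => T - n * s) (at_left s) (at_right (T - n * s)).
Proof.
  intros Hn P HP.
  apply (continuous_reversal T n s) in HP.
  unfold filtermap, at_left, within in *.
  revert HP; apply filter_imp; intros t Ht Hts.
  apply Ht; nra.
Qed.

Lemma reversal_at_right (T n s : R) : 0 < n ->
  filterlim (fun s => T - n * s) (at_right s) (at_left (T - n * s)).
Proof.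
  intros Hn P HP.
  apply (continuous_reversal T n s) in HP.
  unfold filtermap, at_right, within in *.
  revert HP; apply filter_imp; intros t Ht Hts.
  apply Ht; nra.
Qed.

Lemma reversal_bounds (T n s : R) : 0 < n ->
  0 <= s <= T / n -> 0 <= T - n * s <= T.
Proof.
  intros Hn Hs.
  assert (n * (T / n) = T) by (field; lra); nra.
Qed.

Lemma reversal_bounds_lt (T n s : R) : 0 < n ->
  0 < s < T / n -> 0 < T - n * s < T.
Proof.
  intros Hn Hs.
  assert (n * (T / n) = T) by (field; lra); nra.
Qed.

Lemma continuous_linear_map (L : R * R -> R * R) (z : R * R) : is_linear L ->
  filterlim L (locally z) (locally (L z)).
Proof. intros HL; exact (linear_cont L z HL). Qed.

Lemma piecewise_continuous_reversal (L : R * R -> R * R) (T n : R)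
  (u : R -> R * R) : is_linear L -> 0 < n -> piecewise_continuous T u ->
  piecewise_continuous (T / n) (fun s => L (u (T - n * s))).
Proof.
  intros HL Hn [Hl [Hr [l Hc]]].
  assert (HT : n * (T / n) = T) by (field; lra).
  split; [|split].
  - intros s Hs; destruct (Hr (T - n * s)) as [a Ha]; [nra|].
    exists (L a).
    eapply filterlim_comp; [|apply continuous_linear_map, HL].
    eapply filterlim_comp; [apply reversal_at_left, Hn | exact Ha].
  - intros s Hs; destruct (Hl (T - n * s)) as [a Ha]; [nra|].
    exists (L a).
    eapply filterlim_comp; [|apply continuous_linear_map, HL].
    eapply filterlim_comp; [apply reversal_at_right, Hn | exact Ha].
  (* The exceptional times are the preimages of the original ones under the time change. *)
  - exists (map (fun t => (T - t) / n) l); intros s Hs Hin.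
    apply (continuous_comp (fun s => u (T - n * s)) L);
      [|apply continuous_linear_map, HL].
    apply (continuous_comp (fun s : R => T - n * s) u);
      [apply continuous_reversal|].
    apply Hc; [now apply reversal_bounds_lt|].
    intros H; apply Hin, in_map_iff; exists (T - n * s).
    split; [field; lra | exact H].
Qed.

(** The time change sends [[0, T / n]] into [[0, T]], so it respects the [within] filters, endpoints
    included. *)
Lemma continuous_on_segment_reversal (L : R * R -> R * R) (T n : R)
  (f : R -> R * R) : is_linear L -> 0 < n -> continuous_on_segment T f ->
  continuous_on_segment (T / n) (fun s => L (f (T - n * s))).
Proof.
  intros HL Hn Hf s Hs.
  eapply filterlim_comp; [|apply continuous_linear_map, HL].
  eapply filterlim_comp;
    [|apply (Hf (T - n * s)); now apply reversal_bounds].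
  intros P HP.
  apply (continuous_reversal T n s) in HP.
  unfold filtermap, within in *.
  revert HP; apply filter_imp; intros t Ht Hts.
  apply Ht; now apply reversal_bounds.
Qed.

(** * Inversion of return trajectories and comparison of the minima *)

Lemma norm_pos_of_neq0 (v : R * R) : v <> (0, 0) -> 0 < norm v.
Proof.
  intros Hv; destruct (norm_ge_0 v) as [H|H]; [exact H|].
  exfalso; apply Hv, (norm_eq_zero v); now symmetry.
Qed.

Lemma return_time_inversion (v0 : R * R) (T : R) : v0 <> (0, 0) ->
  return_time v0 T -> return_time (scal (/ norm v0 ^ 2) v0) (T / norm v0).
Proof.
  intros Hv0 [HT [x [v [u [[Hpc Hu] [[Hcx [Hcv [Hx Hv]]] [x0 [v0E [xT vT]]]]]]]]].
  assert (Hn := norm_pos_of_neq0 v0 Hv0).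
  set (n := norm v0) in *.
  (* [(p, q)] is the direction of [v0]; the reflection sends it to [(1, 0)] and conversely. *)
  set (p := fst v0 / n); set (q := snd v0 / n).
  assert (Hpq : p ^ 2 + q ^ 2 = 1).
  { assert (Hsq : n ^ 2 = fst v0 ^ 2 + snd v0 ^ 2).
    { unfold n; destruct v0 as [a b]; rewrite norm_pair, pow2_sqrt; simpl; nra. }
    unfold p, q.
    replace (_ + _) with ((fst v0 ^ 2 + snd v0 ^ 2) / n ^ 2) by (field; lra).
    rewrite <- Hsq; field; lra. }
  clearbody n.
  assert (HLu := is_linear_reflect p q Hpq).
  assert (HLx := is_linear_scal_reflect (/ n ^ 2) p q Hpq).
  assert (HLv := is_linear_scal_reflect (- / n) p q Hpq).
  assert (HTn : n * (T / n) = T) by (field; lra).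
  split; [apply Rdiv_le_0_compat; lra|].
  (* Dilation by [/ n] scales position by [/ n ^ 2], velocity by [/ n] and leaves the control
     unscaled; time reversal changes the sign of the velocity only. *)
  exists (fun s => scal (/ n ^ 2) (reflect p q (x (T - n * s)))).
  exists (fun s => scal (- / n) (reflect p q (v (T - n * s)))).
  exists (fun s => reflect p q (u (T - n * s))).
  refine (conj (conj _ _)
    (conj (conj _ (conj _ (conj _ _))) (conj _ (conj _ (conj _ _))))).
  - now apply (piecewise_continuous_reversal (reflect p q)).
  - intros s Hs; rewrite norm_reflect by exact Hpq.
    now apply Hu, reversal_bounds.
  - now apply (continuous_on_segment_reversal
      (fun z => scal (/ n ^ 2) (reflect p q z))).
  - now apply (continuous_on_segment_reversal
      (fun z => scal (- / n) (reflect p q z))).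
  - intros s Hs.
    assert (H := is_derive_linear_reversal _ x T n s _ HLx
      (Hx _ (reversal_bounds_lt _ _ _ Hn Hs))).
    cbv beta in H; rewrite scal_assoc in H.
    replace (- / n) with (mult (- n) (/ n ^ 2)); [exact H|].
    unfold mult; simpl; field; lra.
  - intros s Hs Hc.
    (* The equation for [v] is available only where [u] is continuous, so continuity is carried back
       from the new control by undoing both the time change and the reflection. *)
    assert (Hcu : continuous u (T - n * s)).
    { apply (continuous_ext
        (fun t => reflect p q (reflect p q (u (T - n * ((T - t) / n)))))).
      { intros t; rewrite reflectK by exact Hpq; f_equal; field; lra. }
      apply (continuous_comp (fun t => (T - t) / n)
        (fun s => reflect p q (reflect p q (u (T - n * s))))).
      { apply @ex_derive_continuous; auto_derive; lra. }
      replace ((T - (T - n * s)) / n) with s by (field; lra).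
      apply (continuous_comp (fun s => reflect p q (u (T - n * s)))
        (reflect p q)); [exact Hc | apply continuous_linear_map, HLu]. }
    assert (H := is_derive_linear_reversal _ v T n s _ HLv
      (Hv _ (reversal_bounds_lt _ _ _ Hn Hs) Hcu)).
    cbv beta in H; rewrite scal_assoc in H.
    replace (mult (- n) (- / n)) with (one : R) in H
      by (unfold mult, one; simpl; field; lra).
    now rewrite scal_one in H.
  - replace (T - n * 0) with T by ring; rewrite xT.
    apply injective_projections; cbn; unfold mult; simpl; ring.
  (* The old terminal velocity [(-1, 0)] reflects to [(-p, -q)]; multiplied by [- / n] it becomes
     [v0 / n ^ 2]. *)
  - replace (T - n * 0) with T by ring; rewrite vT.
    apply injective_projections; cbn; unfold mult, p, q; simpl; field; lra.
  - rewrite HTn, Rminus_diag, x0.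
    apply injective_projections; cbn; unfold mult; simpl; ring.
  - rewrite HTn, Rminus_diag, v0E.
    (* The old initial velocity [n (p, q)] reflects to [(n, 0)], and the factor [- / n] makes it the
       prescribed [(-1, 0)]. *)
    replace v0 with (scal n (p, q)).
    2:{ destruct v0 as [a b]; apply injective_projections; cbn; unfold mult, p, q;
        simpl; field; lra. }
    apply injective_projections; cbn; unfold mult; simpl.
    + replace (- / n * (p * (n * p) + q * (n * q))) with (- (p ^ 2 + q ^ 2))
        by (field; lra).
      now rewrite Hpq.
    + ring.
Qed.

Theorem mainTheorem2 (v0 : R * R) (hv0 : v0 <> (0, 0)) (tf tf' : R)
  (htf : optimal_time v0 tf)
  (htf' : optimal_time (scal (/ norm v0 ^ 2) v0) tf') :
  tf' = tf * / norm v0.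
Proof.
  destruct htf as [Hr Hmin], htf' as [Hr' Hmin'].
  assert (Hn := norm_pos_of_neq0 v0 hv0).
  set (n := norm v0) in *.
  (* With this norm, a second inversion multiplies time by [n] and leads back to [v0], which gives
     the reverse inequality. *)
  assert (Hw : norm (scal (/ n ^ 2) v0) = / n).
  { rewrite norm_scal_nonneg.
    - fold n; clearbody n; field; lra.
    - apply Rlt_le, Rinv_0_lt_compat; nra. }
  apply Rle_antisym.
  - now apply Hmin', return_time_inversion.
  - assert (Hw0 : scal (/ n ^ 2) v0 <> (0, 0)).
    { intros H; rewrite H in Hw.
      rewrite norm_pair in Hw.
      replace (0 ^ 2 + 0 ^ 2) with 0 in Hw by ring.
      rewrite sqrt_0 in Hw.
      assert (0 < / n) by now apply Rinv_0_lt_compat.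
      lra. }
    apply (return_time_inversion _ _ Hw0) in Hr'.
    rewrite Hw, scal_assoc in Hr'.
    replace (mult (/ (/ n) ^ 2) (/ n ^ 2)) with (one : R) in Hr'
      by (unfold mult, one; simpl; field; lra).
    rewrite scal_one in Hr'.
    apply Hmin in Hr'.
    apply Rmult_le_reg_r with n; [exact Hn|].
    replace (tf * / n * n) with tf by (field; lra).
    now replace (tf' * n) with (tf' / / n) by (field; lra).
Qed.
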